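(* Let $g(X,Y)=XY(X-Y)$. (1) For $a,b\in\mathbb{Z}$, we can write $g(a,b)=2(a-b)\cdot\frac{a}{2}\cdot b$. Conversely, given $a,d\in\mathbb{Q}$, we have $2a(a+d)(a+2d)=g(2a+2d,a+2d)$. Thus a cube-free integer $n>1$ is a rational cube sum if and only if $n$ is twice the product of three rational numbers in arithmetic progression. In particular, $2n(n+k)(n+2k)$ is a rational cube sum for all $n,k\in\mathbb{Z}$. (2) For $x,y\in\mathbb{Z}$, the numbers $xy(x^{3k+1}\pm y^{3k+1})=g(\mp x^{3k+1},y^{3k+1})$ are rational cube sums. In particular, the product of any two consecutive integers is a rational cube sum. (3) For a Pythagorean triplet $(a,b,c)$, $g(c^2,a^2)=(abc)^2$ is a rational cube sum. So there are infinitely many perfect square integers which are rational cube sums. (4) The product of three consecutive terms in the Fibonacci sequence is a rational cube sum.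
   Context: An integer $n$ is called a rational cube sum if there exist rational numbers $\alpha,\beta\in\mathbb{Q}$ with $n=\alpha^3+\beta^3$. Three rational numbers in arithmetic progression are numbers of the form $a,a+d,a+2d$ with $a,d\in\mathbb{Q}$. In (2), $k$ is an integer parameter, for which no further range is stated. A Pythagorean triplet $(a,b,c)$ consists of positive integers with $a^2+b^2=c^2$. The Fibonacci sequence is $F_0=0$, $F_1=1$, $F_{n+2}=F_{n+1}+F_n$.
   Formalization: In (2) the displayed equality fails for k ≠ 0 in general (x=2, y=1, k=1: 34 versus 272); it is replaced by g(∓x^{3k+1}, y^{3k+1}) = (xy)^{3k}·xy(x^{3k+1} ± y^{3k+1}), and both sides are shown to be rational cube sums. *)

(* Defs.v *)
From mathcomp Require Import all_boot all_order all_algebra.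
From mathcomp Require Import classical_sets cardinality.

Set Implicit Arguments.
Unset Strict Implicit.
Unset Printing Implicit Defensive.

Import Order.TTheory GRing.Theory Num.Theory.
Local Open Scope ring_scope.

Definition g {R : pzRingType} (X Y : R) : R := X * Y * (X - Y).

(* Stated for a rational q, since x y (x^(3k+1) +- y^(3k+1)) need not be an
   integer when k < 0; an integer n is a rational cube sum iff n%:Q is. *)
Definition rational_cube_sum (q : rat) : Prop :=
  exists alpha beta : rat, q = alpha ^+ 3 + beta ^+ 3.

Definition cube_free (n : int) : Prop :=
  forall p : nat, prime p -> ~~ (p%:Z ^+ 3 %| n)%Z.

Definition twice_prod_arith_prog3 (q : rat) : Prop :=
  exists a d : rat, q = 2 * (a * (a + d) * (a + 2 * d)).

Definition pythagorean_triplet (a b c : int) : Prop :=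
  [/\ 0 < a, 0 < b, 0 < c & a ^+ 2 + b ^+ 2 = c ^+ 2].

Definition perfect_square (n : int) : Prop := exists m : int, n = m ^+ 2.

Fixpoint fib (n : nat) : nat :=
  match n with
  | 0 => 0
  | 1 => 1
  | (m.+1 as n').+1 => (fib n' + fib m)%N
  end.

(* Main.v *)
Require Import Defs.
From mathcomp Require Import all_boot all_order all_algebra.
From mathcomp Require Import classical_sets cardinality.
From mathcomp Require Import zify ring lra.

Set Implicit Arguments.
Unset Strict Implicit.
Unset Printing Implicit Defensive.

Import Order.TTheory GRing.Theory Num.Theory.
Local Open Scope classical_set_scope.
Local Open Scope ring_scope.

(** Everything rests on one fact: for rational [x], [y], the number
    [g x y = x y (x - y)] is a sum of two rational cubes ([cube_sum_g]).  This
    is the classical 3-isogeny from the curve [X Y (X - Y) = n Z^3] to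
    [X^3 + Y^3 = n Z^3], given by explicit cubic forms over the common
    denominator [3 (x^2 - x y + y^2)], a positive definite form.

    The dual isogeny goes back: if [n = alpha^3 + beta^3] with
    [alpha beta != 0], then [n = g (- alpha^2 / beta) (beta^2 / alpha)]
    ([cubeD_g]).  The points with [alpha beta = 0] only occur when [n] is the
    cube of a rational number, hence of an integer, which a cube-free [n > 1]
    is not ([cube_free_neq_cube]).  Since being of the form [g x y] and being
    twice a product of three rationals in arithmetic progression are the same
    up to a linear change of variables, (1) follows.  The families in (2), (3)
    and (4) are values of [g], up to a rational cube in (2); in (4) because
    [F_{n+2} - F_n = F_{n+1}]. *)

(** The image of [(x, y)] under the 3-isogeny. *)
Lemma cube_sum_g (x y : rat) : rational_cube_sum (g x y).
Proof.
have [->|y0] := eqVneq y 0; first by exists 0, 0; rewrite /g; ring.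
have D_neq0 : x ^+ 2 - x * y + y ^+ 2 != 0.
  have y2_gt0 : 0 < y ^+ 2 by rewrite lt_def sqrf_eq0 y0 sqr_ge0.
  have sq_ge0 := sqr_ge0 (x - y / 2).
  by apply: lt0r_neq0; nra.
exists ((x ^+ 3 + y ^+ 3 - 6 * x ^+ 2 * y + 3 * x * y ^+ 2)
          / (- 3 * (x ^+ 2 - x * y + y ^+ 2))).
exists ((x ^+ 3 + y ^+ 3 + 3 * x ^+ 2 * y - 6 * x * y ^+ 2)
          / (3 * (x ^+ 2 - x * y + y ^+ 2))).
by rewrite /g; field.
Qed.

Lemma rational_cube_sumM_cube (c q : rat) :
  rational_cube_sum q -> rational_cube_sum (c ^+ 3 * q).
Proof.
by move=> [u [v ->]]; exists (c * u), (c * v); rewrite mulrDr !exprMn.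
Qed.

(** The image of [(alpha, beta)] under the dual isogeny. *)
Lemma cubeD_g (alpha beta : rat) : alpha != 0 -> beta != 0 ->
  alpha ^+ 3 + beta ^+ 3 = g (- (alpha ^+ 2 / beta)) (beta ^+ 2 / alpha).
Proof. by move=> a0 b0; rewrite /g; field; rewrite a0 b0. Qed.

Lemma g_twice_prod_arith_prog3 (x y : rat) : twice_prod_arith_prog3 (g x y).
Proof. by exists (x - y), (y - x / 2); rewrite /g; field. Qed.

Lemma arith_prog3_g (a d : rat) :
  2 * a * (a + d) * (a + 2 * d) = g (2 * a + 2 * d) (a + 2 * d).
Proof. by rewrite /g; ring. Qed.

Lemma cube_free_neq_cube (n : int) (q : rat) :
  1 < n -> cube_free n -> n%:Q <> q ^+ 3.
Proof.
move=> n_gt1 n_cf nE.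
have numE : numq q ^+ 3 = n * denq q ^+ 3.
  apply: (@intr_inj rat); rewrite rmorphXn intrM rmorphXn /= nE -exprMn.
  by rewrite -{2}[q]divq_num_den divfK ?intr_eq0 ?denq_neq0.
have absE : (`|numq q| ^ 3 = `|n| * `|denq q| ^ 3)%N.
  by rewrite -!abszX -abszM numE.
(* The denominator divides the numerator cubed and is coprime to it. *)
have den1 : `|denq q|%N = 1%N.
  apply/eqP; rewrite -dvdn1 -(@Gauss_dvdr _ (`|numq q| ^ 3)) ?muln1.
    by rewrite absE dvdn_mull // expnS dvdn_mulr.
  by rewrite coprime_sym coprimeXl // coprime_num_den.
have nabs : (`|n| = `|numq q| ^ 3)%N by rewrite absE den1 muln1.
have num_gt1 : (1 < `|numq q|)%N.
  have : (1 < `|n|)%N by lia.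
  by rewrite nabs; case: `|numq q|%N => [|[|]].
have /negP := n_cf _ (pdiv_prime num_gt1); apply.
by rewrite dvdzE abszX /= nabs dvdn_exp2r // pdiv_dvd.
Qed.

Lemma rational_cube_sum_cube_free (n : int) : 1 < n -> cube_free n ->
  (rational_cube_sum n%:Q <-> twice_prod_arith_prog3 n%:Q).
Proof.
move=> n_gt1 n_cf; split=> [[u [v nE]]|[a [d ->]]]; last first.
  by rewrite !mulrA arith_prog3_g; apply: cube_sum_g.
have [u0|u0] := eqVneq u 0.
  by case: (cube_free_neq_cube (q := v) n_gt1 n_cf); rewrite nE u0; ring.
have [v0|v0] := eqVneq v 0.
  by case: (cube_free_neq_cube (q := u) n_gt1 n_cf); rewrite nE v0; ring.
by rewrite nE cubeD_g //; apply: g_twice_prod_arith_prog3.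
Qed.

(** For [x = 0] this needs [3 k + 1 != 0], as [0 ^ 0 = 1]. *)
Lemma exprz_3kD1 (F : fieldType) (x : F) (k : int) :
  x ^ (3 * k + 1) = (x ^ k) ^+ 3 * x.
Proof.
have [->|x0] := eqVneq x 0.
  by rewrite mulr0 exp0rz; case: eqP => //; lia.
by rewrite expfzDr // expr1z (mulrC 3) -exprz_exp.
Qed.

(** Dividing by the cube [c^3], unless it vanishes. *)
Lemma rational_cube_sum_divl (c p q : rat) : (c = 0 -> q = 0) ->
  p = c ^+ 3 * q -> rational_cube_sum p -> rational_cube_sum q.
Proof.
move=> c0q pE /(rational_cube_sumM_cube c^-1); rewrite pE mulrA -exprMn.
have [/c0q->|c0] := eqVneq c 0; first by rewrite mulr0.
by rewrite mulVf // expr1n mul1r.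
Qed.

(** The multiples [(3 t, 4 t, 5 t)] of one triplet suffice: the squares
    [(60 t^3)^2] are pairwise distinct for natural [t]. *)
Lemma infinite_square_cube_sum :
  infinite_set [set n : int | perfect_square n /\ rational_cube_sum n%:Q].
Proof.
pose f (t : nat) : int := (60 * t%:Z ^+ 3) ^+ 2.
apply: (@sub_infinite_set _ (range f)).
  move=> _ [t _ <-]; split; first by exists (60 * t%:Z ^+ 3).
  have -> : (f t)%:Q = g ((5 * t%:Q) ^+ 2) ((3 * t%:Q) ^+ 2).
    by rewrite /f /g !(rmorphM, rmorphXn) /=; ring.
  exact: cube_sum_g.
have f_inj : injective f.
  move=> s t /eqP; rewrite /f eqrXn2 ?mulr_ge0 ?exprn_ge0 //.
  rewrite (inj_eq (mulfI _)) // eqrXn2 //.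
  by rewrite eqz_nat => /eqP.
apply/infiniteP; have : (range f #= [set: nat])%card.
  by apply: inj_card_eq; exact: in2W.
by rewrite card_eq_le => /andP[].
Qed.

(* In (2) the displayed equality is an equality up to the cube ((x y)^k)^3:
   as an equality of numbers it holds only for k = 0 (and degenerate x, y;
   e.g. x = 2, y = 1, k = 1 gives 34 and 272). There k ranges over all of int,
   with exponentiation in rat, where 0 to a negative power is 0. *)
Theorem corollary1p16 :
  (* (1) *)
  [/\ (forall a b : int,
         (g a b)%:Q = 2 * (a%:Q - b%:Q) * (a%:Q / 2) * b%:Q),
      (forall a d : rat,
         2 * a * (a + d) * (a + 2 * d) = g (2 * a + 2 * d) (a + 2 * d)),
      (forall n : int, 1 < n -> cube_free n ->
         (rational_cube_sum n%:Q <-> twice_prod_arith_prog3 n%:Q)) &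
      (forall n k : int,
         rational_cube_sum (2 * n * (n + k) * (n + 2 * k))%:Q)]
  /\
  (* (2) *)
  ((forall x y k : int,
      let X : rat := x%:Q in
      let Y : rat := y%:Q in
      let m : int := 3 * k + 1 in
      [/\ g (- X ^ m) (Y ^ m) = ((X * Y) ^ k) ^+ 3 * (X * Y * (X ^ m + Y ^ m)),
          g (X ^ m) (Y ^ m) = ((X * Y) ^ k) ^+ 3 * (X * Y * (X ^ m - Y ^ m)),
          rational_cube_sum (X * Y * (X ^ m + Y ^ m))
            /\ rational_cube_sum (X * Y * (X ^ m - Y ^ m)) &
          rational_cube_sum (g (- X ^ m) (Y ^ m))
            /\ rational_cube_sum (g (X ^ m) (Y ^ m))])
   /\ (forall n : int, rational_cube_sum (n * (n + 1))%:Q))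
  /\
  (* (3) *)
  ((forall a b c : int, pythagorean_triplet a b c ->
      g (c ^+ 2) (a ^+ 2) = (a * b * c) ^+ 2
      /\ rational_cube_sum ((a * b * c) ^+ 2)%:Q)
   /\ infinite_set [set n : int | perfect_square n /\ rational_cube_sum n%:Q])
  /\
  (* (4) *)
  (forall n : nat,
     rational_cube_sum (fib n * fib n.+1 * fib n.+2)%N%:Q).
Proof.
split; [|split; [|split]].
- split.
  + by move=> a b; rewrite /g !(rmorphM, rmorphB) /=; field.
  + exact: arith_prog3_g.
  + exact: rational_cube_sum_cube_free.
  + move=> n k; have -> : (2 * n * (n + k) * (n + 2 * k))%:Q
                        = 2 * n%:Q * (n%:Q + k%:Q) * (n%:Q + 2 * k%:Q).
      by rewrite !(rmorphM, rmorphD) /=.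
    by rewrite arith_prog3_g; apply: cube_sum_g.
- split; last first.
    move=> n; have -> : (n * (n + 1))%:Q = g (n%:Q + 1) n%:Q.
      by rewrite /g rmorphM rmorphD /=; ring.
    exact: cube_sum_g.
  move=> x y k X Y m.
  have powM : X ^ m * Y ^ m = ((X * Y) ^ k) ^+ 3 * (X * Y).
    by rewrite -expfzMl exprz_3kD1.
  have plusE : g (- X ^ m) (Y ^ m)
             = ((X * Y) ^ k) ^+ 3 * (X * Y * (X ^ m + Y ^ m)).
    by rewrite mulrA -powM /g; ring.
  have minusE : g (X ^ m) (Y ^ m)
             = ((X * Y) ^ k) ^+ 3 * (X * Y * (X ^ m - Y ^ m)).
    by rewrite mulrA -powM /g.
  have XYk0 z : (X * Y) ^ k = 0 -> X * Y * z = 0.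
    by move/eqP; rewrite expfz_eq0 => /andP[_ /eqP ->]; rewrite mul0r.
  split=> //; split; try exact: cube_sum_g.
    exact: rational_cube_sum_divl (XYk0 _) plusE (cube_sum_g _ _).
  exact: rational_cube_sum_divl (XYk0 _) minusE (cube_sum_g _ _).
- split; last exact: infinite_square_cube_sum.
  move=> a b c [_ _ _ abc].
  have gE : g (c ^+ 2) (a ^+ 2) = (a * b * c) ^+ 2.
    have bE : c ^+ 2 - a ^+ 2 = b ^+ 2 by rewrite -abc; ring.
    by rewrite /g bE; ring.
  split=> //; rewrite -gE.
  have -> : (g (c ^+ 2) (a ^+ 2))%:Q = g (c%:Q ^+ 2) (a%:Q ^+ 2).
    by rewrite /g !(rmorphM, rmorphB, rmorphXn) /=.
  exact: cube_sum_g.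
- move=> n.
  have -> : (fib n * fib n.+1 * fib n.+2)%N%:Q
          = g (fib n.+2)%:Q (fib n)%:Q.
    have -> : fib n.+2 = (fib n.+1 + fib n)%N by [].
    by rewrite /g !PoszM !PoszD !(rmorphM, rmorphD) /=; ring.
  exact: cube_sum_g.
Qed.
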